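(* There exist a sequence of integers $(n_i)$, a separable metric space $(Y,d)$ and an isometry $S$ on $Y$ such that $S$ is topologically uniformly rigid with respect to $(n_i)$, but for any finite (nonzero) Borel measure $\nu$ on $Y$ which is ergodic and nonsingular with respect to $S$, the system $(Y,\nu,S)$ is not measure-theoretically rigid with respect to $(n_i)$.
   Context: $S$ is an invertible isometry of $(Y,d)$. $S$ is topologically uniformly rigid with respect to $(n_i)$ if $\sup_{y\in Y}d(S^{n_i}y,y)\to 0$ as $i\to\infty$. A Borel measure $\nu$ on $Y$ is nonsingular with respect to $S$ if $\nu(A)=0$ if and only if $\nu(S^{-1}A)=0$ for Borel $A$; it is ergodic if $\nu(S^{-1}A\triangle A)=0$ implies $\nu(A)=0$ or $\nu(A^c)=0$. For a finite nonsingular measure $\nu$, $(Y,\nu,S)$ is measure-theoretically rigid with respect to $(n_i)$ if $\nu(S^{-n_i}A\triangle A)\to 0$ as $i\to\infty$ for every Borel set $A\subseteq Y$. *)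

(* Defs.v *)
From HB Require Import structures.
From mathcomp Require Import all_boot all_order all_algebra.
From mathcomp Require Import all_classical all_reals all_analysis.

Set Implicit Arguments.
Unset Strict Implicit.
Unset Printing Implicit Defensive.

Import Order.TTheory GRing.Theory Num.Theory.

Local Open Scope classical_set_scope.
Local Open Scope ring_scope.

(* Measurable types of the library are pointed, so the carrier of a Borel space
   must be a pointed metric space; the distinguished point plays no other role
   than making the space nonempty. *)
#[short(type="pmetricType")]
HB.structure Definition PointedMetric (K : numDomainType) :=
  { M of Metric K M & isPointed M }.

Notation borelType Y := (g_sigma_algebraType (@open Y)).

Definition separable (T : topologicalType) : Prop :=
  exists2 D : set T, countable D & dense D.

Record invertible_isometry (R : realType) (Y : metricType R) := InvertibleIsometry {
  isom_fun :> Y -> Y ;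
  isom_inv : Y -> Y ;
  isom_funK : cancel isom_fun isom_inv ;
  isom_invK : cancel isom_inv isom_fun ;
  isom_dist : forall x y, mdist (isom_fun x) (isom_fun y) = mdist x y
}.

Section dynamics.
Context {R : realType}.

Definition isom_pow (Y : metricType R) (S : invertible_isometry Y) (n : int) :
    Y -> Y :=
  match n with
  | Posz k => iter k S
  | Negz k => iter k.+1 (isom_inv S)
  end.

(* The supremum is taken in the extended reals, because the real-valued [sup]
   of the library is 0 on unbounded sets. *)
Definition uniformly_rigid (Y : metricType R) (S : invertible_isometry Y)
    (n : nat -> int) : Prop :=
  ereal_sup [set (mdist (isom_pow S (n i) y) y)%:E | y in [set: Y]]
    @[i --> \oo] --> 0%E.

Section measured.
Context {Y : pmetricType R}.
Implicit Types (S : invertible_isometry Y)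
  (nu : {finite_measure set (borelType Y) -> \bar R}).

Definition nonsingular nu S : Prop :=
  forall A : set (borelType Y), measurable A ->
    nu A = 0%E <-> nu (S @^-1` A) = 0%E.

Definition ergodic nu S : Prop :=
  forall A : set (borelType Y), measurable A ->
    nu ((S @^-1` A) `+` A) = 0%E -> nu A = 0%E \/ nu (~` A) = 0%E.

Definition measure_rigid nu S (n : nat -> int) : Prop :=
  forall A : set (borelType Y), measurable A ->
    nu ((isom_pow S (n i) @^-1` A) `+` A) @[i --> \oo] --> 0%E.

End measured.
End dynamics.

(* Main.v *)
From HB Require Import structures.
Require Import Defs.
From mathcomp Require Import all_boot all_order all_algebra.
From mathcomp Require Import all_classical all_reals all_analysis.

(** The dyadic metric makes [x |-> x + 1] an isometry of the integers that is
    uniformly rigid along [n_i = 2 ^ i], since [2 ^ i] tends to [0]. The integers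
    are countable, so a nonzero Borel measure has an atom [y]; no power [S^(n_i)]
    fixes [y], so [{y}] and its preimage stay disjoint and their symmetric
    difference keeps at least the mass of the atom. *)

Import Order.TTheory GRing.Theory Num.Theory.
Import numFieldNormedType.Exports.

Local Open Scope classical_set_scope.
Local Open Scope ring_scope.

Section countable_space.
Context {R : realType} {Y : pmetricType R}.
Implicit Type nu : {finite_measure set (borelType Y) -> \bar R}.
Hypothesis Ycount : countable [set: Y].

(** Points are closed in a metric space, hence Borel, and here every set is a countable union of
    points. *)
Lemma countable_borel_measurable (A : set (borelType Y)) : measurable A.
Proof.
apply: countable_measurable; last exact: sub_countable (subset_card_le (@subsetT _ A)) Ycount.
move=> y; rewrite -[X in measurable X]setCK; apply: measurableC.
apply: sub_sigma_algebra; apply: closed_openC.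
exact/accessible_closed_set1/hausdorff_accessible/metric_hausdorff.
Qed.

Lemma countable_measure_atom nu :
  nu [set: borelType Y] <> 0%E -> exists y : borelType Y, nu [set y] <> 0%E.
Proof.
move=> nu0; apply: contrapT => /forallNP noatom; apply: nu0.
have /countable_injP[f finj] := Ycount.
(* An injection [f] into [nat] cuts the space into a sequence of fibers, each empty or a single
   point. If no point had mass, countable subadditivity would make the whole space null. *)
have fiber k : nu.-negligible (f @^-1` [set k] : set (borelType Y)).
  apply/negligibleP; first exact: countable_borel_measurable.
  have [[y fy]|nfy] := pselect (exists y, f y = k); last first.
    rewrite (_ : _ @^-1` _ = set0) ?measure0//.
    by apply/seteqP; split => // y /= fy; apply: nfy; exists y.
  rewrite (_ : _ @^-1` _ = [set y]); first exact: contrapT (noatom y).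
  by apply/seteqP; split => [z /= fz|z ->//]; apply: finj; rewrite ?inE// fz.
apply/negligibleP; first exact: measurableT.
by apply: negligibleS (negligible_bigcup fiber) => y _; exists (f y).
Qed.

Lemma countable_not_measure_rigid (S : invertible_isometry Y) (n : nat -> int)
    nu :
  (forall i y, isom_pow S (n i) y <> y) ->
  nu [set: borelType Y] <> 0%E -> ~ measure_rigid nu S n.
Proof.
move=> nfix /countable_measure_atom[y nuy].
move=> /(_ _ (countable_borel_measurable [set y])) cvg0.
(* The constant [nu [set y]] bounds the sequence from below, so it also bounds the limit 0. *)
apply/nuy/eqP; rewrite -measure_le0; apply: cvge_ge cvg0; near=> i.
apply: le_measure; rewrite ?inE; [exact: countable_borel_measurable..|].
by move=> z ->; right; split => //; exact: nfix.
Unshelve. all: by end_near. Qed.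

End countable_space.

(** This is the 2-adic absolute value. Zero is treated apart because [logn 2 0] is 0, which would
    give it norm 1. *)
Definition dyadic_norm {R : realType} (x : int) : R :=
  if x == 0 then 0 else 2^-1 ^+ logn 2 `|x|.

Section dyadic_norm.
Context {R : realType}.
Implicit Types x y : int.
Local Notation dyadic_norm := (@dyadic_norm R).

Lemma dyadic_norm_ge0 x : 0 <= dyadic_norm x.
Proof. by rewrite /dyadic_norm; case: ifP => // _; rewrite exprn_ge0// invr_ge0. Qed.

Lemma dyadic_norm0_eq0 x : dyadic_norm x = 0 -> x = 0.
Proof.
rewrite /dyadic_norm; case: eqP => // _ /eqP.
by rewrite expf_eq0 invr_eq0 pnatr_eq0 andbF.
Qed.

Lemma dyadic_normN x : dyadic_norm (- x) = dyadic_norm x.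
Proof. by rewrite /dyadic_norm oppr_eq0 abszN. Qed.

(** The closed balls around 0 are thus the subgroups of multiples of [2 ^ k], so norm estimates
    become divisibility statements. *)
Lemma dyadic_norm_le_exp x k :
  (dyadic_norm x <= 2^-1 ^+ k) = ((2 ^ k)%N %| x)%Z.
Proof.
rewrite /dyadic_norm; case: eqVneq => [->|x0].
  by rewrite exprn_ge0 ?invr_ge0// dvdz0.
rewrite dvdzE/= pfactor_dvdn ?absz_gt0//.
by rewrite ler_iXn2l ?invr_gt0// invf_lt1 ?ltr1n.
Qed.

Lemma dyadic_norm_exp k : dyadic_norm (2 ^ k)%N%:Z = 2^-1 ^+ k.
Proof.
by rewrite /dyadic_norm -[_%:Z == 0]/(2 ^ k == 0)%N expn_eq0/= pfactorK.
Qed.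

Lemma dyadic_normD x y :
  dyadic_norm (x + y) <= dyadic_norm x + dyadic_norm y.
Proof.
wlog xy : x y / dyadic_norm x <= dyadic_norm y.
  move=> H; have [/H//|/ltW/H] := leP (dyadic_norm x) (dyadic_norm y).
  by rewrite addrC [leRHS]addrC.
(* The stronger ultrametric bound holds: for nonzero [y], the power of 2 that determines the norm of
   [y] divides both [x] and [y], hence their sum. *)
apply: (@le_trans _ _ (dyadic_norm y)); last by rewrite lerDr dyadic_norm_ge0.
have [y0|y0] := eqVneq y 0.
  by move: xy; rewrite y0 addr0.
have yE : dyadic_norm y = 2^-1 ^+ logn 2 `|y| by rewrite /dyadic_norm (negbTE y0).
by rewrite yE dyadic_norm_le_exp rpredD// -dyadic_norm_le_exp -yE.
Qed.

End dyadic_norm.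

(** A separate name for the integers carries the 2-adic metric; the parameter [R] records where
    distances take their values. *)
Definition dyadic (R : realType) : Type := int.

HB.instance Definition _ (R : realType) := Countable.on (dyadic R).

Section dyadic_metric.
Context {R : realType}.
Let dist (x y : dyadic R) : R := dyadic_norm ((x : int) - (y : int)).

Let distxx x : dist x x = 0.
Proof. by rewrite /dist subrr /dyadic_norm eqxx. Qed.

Let dist_positivity x y : dist x y = 0 -> x = y.
Proof. by move=> /dyadic_norm0_eq0/eqP; rewrite subr_eq0 => /eqP. Qed.

Let dist_sym x y : dist x y = dist y x.
Proof. by rewrite /dist -dyadic_normN opprB. Qed.

Let dist_triangle y x z : dist x z <= dist x y + dist y z.
Proof.
rewrite /dist (_ : (x : int) - z = ((x : int) - y) + ((y : int) - z)).
  exact: dyadic_normD.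
by rewrite addrA subrK.
Qed.

HB.instance Definition _ := isMetric.Build R (dyadic R)
  distxx dist_positivity dist_sym dist_triangle.
HB.instance Definition _ := isPointed.Build (dyadic R) (0 : int).

Lemma dyadic_mdist (x y : dyadic R) :
  mdist x y = dyadic_norm ((x : int) - (y : int)).
Proof. by []. Qed.

Lemma dyadic_countable : countable [set: dyadic R].
Proof. exact: countableP. Qed.

Lemma dyadic_separable : separable (dyadic R).
Proof.
by exists [set: dyadic R]; [exact: dyadic_countable|move=> O; rewrite setIT].
Qed.

Let succ (x : dyadic R) : dyadic R := (x : int) + 1.
Let pred (x : dyadic R) : dyadic R := (x : int) - 1.

Let succK : cancel succ pred. Proof. by move=> x; exact: addrK. Qed.
Let predK : cancel pred succ. Proof. by move=> x; exact: subrK. Qed.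

Let dist_succ (x y : dyadic R) : mdist (succ x) (succ y) = mdist x y.
Proof. by rewrite !dyadic_mdist /succ opprD addrACA subrr addr0. Qed.

Definition dyadic_shift : invertible_isometry (dyadic R) :=
  InvertibleIsometry succK predK dist_succ.

Lemma dyadic_shift_pow (k : nat) (x : dyadic R) :
  isom_pow dyadic_shift k x = (x : int) + k%:Z.
Proof.
rewrite /=; elim: k => [|k IH]; first by rewrite addr0.
by rewrite iterS IH /= /succ -addrA -PoszD addn1.
Qed.

Lemma mdist_dyadic_shift_pow (i : nat) (x : dyadic R) :
  mdist (isom_pow dyadic_shift (2 ^ i)%N x) x = 2^-1 ^+ i.
Proof.
by rewrite dyadic_mdist dyadic_shift_pow addrAC subrr add0r dyadic_norm_exp.
Qed.

Lemma dyadic_shift_uniformly_rigid :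
  uniformly_rigid dyadic_shift (fun i => (2 ^ i)%N%:Z).
Proof.
rewrite /uniformly_rigid (_ : (fun i => _) = fun i => (2^-1 ^+ i)%:E).
  apply: cvg_EFin; first exact: nearW.
  by apply: cvg_expr; rewrite ger0_norm ?invr_ge0// invf_lt1 ?ltr1n.
(* By translation invariance all points move by the same distance [2^-1 ^+ i], so the supremum is
   over a singleton; [point] shows that this value is attained. *)
apply/funext => i; rewrite -[RHS]ereal_sup1; congr ereal_sup.
apply/seteqP; split => [_ [y _ <-]|_ ->]; first by rewrite mdist_dyadic_shift_pow.
by exists point; rewrite ?mdist_dyadic_shift_pow.
Qed.

End dyadic_metric.

Theorem theorem5p3 (R : realType) :
  exists (n : nat -> int) (Y : pmetricType R) (S : invertible_isometry Y),
    separable Y /\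
    uniformly_rigid S n /\
    (forall nu : {finite_measure set (borelType Y) -> \bar R},
       nu [set: borelType Y] <> 0%E ->
       ergodic nu S -> nonsingular nu S -> ~ measure_rigid nu S n).
Proof.
exists (fun i => (2 ^ i)%N%:Z), (dyadic R), dyadic_shift.
split; first exact: dyadic_separable.
split; first exact: dyadic_shift_uniformly_rigid.
move=> nu nu0 _ _; apply: countable_not_measure_rigid nu0.
  exact: dyadic_countable.
move=> i y; rewrite dyadic_shift_pow => fixy.
have /eqP : (2 ^ i)%N%:Z = 0 by apply: (@addrI int y); rewrite addr0.
by rewrite eqz_nat expn_eq0.
Qed.
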